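(* Let $G$ be a finite group and $H$ a subgroup such that the interval $[H,G]$ is boolean, and let $L$ be a coatom of $[H,G]$ with $|G:L| = 2$. If $[H,L]$ is linearly primitive, then so is $[H,G]$.
   Context: For a subgroup $H$ of a finite group $G$, $[H,G]$ denotes the lattice of all subgroups $K$ with $H \subseteq K \subseteq G$, ordered by inclusion, with $K_1 \vee K_2 = \langle K_1, K_2\rangle$ and $K_1 \wedge K_2 = K_1 \cap K_2$. The interval is boolean if this lattice is a boolean lattice (distributive and every element has a unique complement), equivalently isomorphic to the subset lattice $B_n$ of $\{1,\dots,n\}$ for some $n$ (the rank). A coatom is a maximal element among the elements different from $G$, i.e. a maximal subgroup of $G$ containing $H$. For a representation $V$ of a group $G$ and a subgroup $H$, $V^H = \{v\in V \mid hv=v \ \forall h \in H\}$; for a subspace $X \subseteq V$, $G_{(X)} = \{g\in G \mid gx = x \ \forall x\in X\}$. An interval $[H,G]$ is called linearly primitive if there is an irreducible complex representation $V$ of $G$ such that $G_{(V^H)} = H$. *)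

(* Defs.v *)
From mathcomp Require Import all_boot all_order all_algebra all_fingroup.
From mathcomp Require Import all_solvable mxrepresentation.
From mathcomp Require Import reals complex.

Set Implicit Arguments.
Unset Strict Implicit.
Unset Printing Implicit Defensive.

Local Open Scope group_scope.

Section Interval.

Variable gT : finGroupType.
Implicit Types H G K : {group gT}.

Definition in_interval H G K : bool := (H \subset K) && (K \subset G).

Definition interval_distributive H G : Prop :=
  forall K1 K2 K3 : {group gT},
    in_interval H G K1 -> in_interval H G K2 -> in_interval H G K3 ->
    K1 :&: (K2 <*> K3) = (K1 :&: K2) <*> (K1 :&: K3).

Definition interval_complement H G K K' : Prop :=
  [/\ in_interval H G K', K :&: K' = H & K <*> K' = G].

Definition boolean_interval H G : Prop :=
  interval_distributive H G /\
  (forall K : {group gT}, in_interval H G K ->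
     exists! K' : {group gT}, interval_complement H G K K').

Definition interval_coatom H G K : bool := (H \subset K) && maximal K G.

(* Representations act on row vectors on the right: v is sent to v *m rG g.
   V^H is the row space of [rfix_mx rG H], and [rstab rG U] is the pointwise
   stabiliser in G of the row space of U. *)
Definition linearly_primitive (R : realType) H G : Prop :=
  exists (n : nat) (rG : mx_representation R[i] G n),
    mx_irreducible rG /\ rstab rG (rfix_mx rG H) = H.

End Interval.

(* Main.v *)
Require Import Defs.
From mathcomp Require Import all_boot all_order all_algebra all_fingroup.
From mathcomp Require Import all_solvable mxrepresentation.
From mathcomp Require Import reals complex.
From mathcomp Require boolp.

(** Let [V] be an irreducible representation of [L] with [L_(V^H) = H].

    Some irreducible representation [W] of [G] contains a copy of [V] when
    restricted to [L]: map [V] to the group algebra of [G] by Frobenius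
    reciprocity and project onto a simple summand, which exists by Maschke's
    theorem ([hom_irreducible_constituent]).  As [W^H] contains a copy of
    [V^H], an element of [L] that fixes [W^H] pointwise fixes [V^H] as well,
    so [L :&: G_(W^H) = H] ([stab_fixed_constituent]).  If [V^H = 0] then
    [H = L], and the trivial representation of [G] serves as [W]; hence [W^H]
    may be taken nonzero ([irreducible_stab_cap]).

    Twist [W] by the sign character of [G / L].  The twist is still
    irreducible.  As [H] lies in [L], it has the same [H]-fixed space [W^H],
    and the stabiliser [K'] of that space in the twist agrees on [L] with the
    stabiliser [K] in [W]: both meet [L] in [H].  If neither [K] nor [K'] is
    [H], then neither lies in the maximal subgroup [L], so both are
    complements of [L] in the interval, and [K = K'] since complements are
    unique ([boolean_interval_maximal_compl]).  But an element of [K] outside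
    [L] acts on [W^H] as the identity, and in the twist as minus the identity,
    which is absurd when [2 != 0] and [W^H != 0].  So [W] or its twist
    witnesses that the interval is linearly primitive
    ([irreducible_stab_of_stab_cap]). *)

Local Open Scope group_scope.

Set Implicit Arguments.
Unset Strict Implicit.
Unset Printing Implicit Defensive.

Import GRing.Theory Num.Theory.

(** * Embedding into the restriction of an irreducible representation *)

Definition intertwines (F : fieldType) (gT : finGroupType) (L G : {group gT})
    (n m : nat) (rL : mx_representation F L n) (rG : mx_representation F G m)
    (B : 'M[F]_(n, m)) : Prop :=
  forall x, x \in L -> (rL x *m B = B *m rG x)%R.

(** Frobenius reciprocity for the regular representation, written out: a
    column [c] is a linear form on [V], and the map sends [v] to the element
    [\sum_(g in L) (v *m rL g^-1 *m c) g] of the group algebra. *)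
Lemma intertwines_regular (F : fieldType) (gT : finGroupType)
    (L G : {group gT}) (n : nat) (rL : mx_representation F L n) :
  L \subset G -> 0 < n ->
  exists2 B, B != 0%R & intertwines rL (regular_repr F G) B.
Proof.
move=> sLG n_gt0.
pose c : 'cV[F]_n := const_mx 1%R.
pose u g : 'cV[F]_n := if g \in L then (rL g^-1%g *m c)%R else 0%R.
pose B : 'M[F]_(n, gcard G) := (\matrix_(i, j) u (enum_val j) i 0)%R.
have colB j : col j B = u (enum_val j) by apply/colP=> i; rewrite !mxE.
exists B.
  apply/eqP=> /matrixP /(_ (Ordinal n_gt0) (gring_index G 1)).
  rewrite !mxE gring_indexK // /u group1 invg1 repr_mx1 mul1mx mxE.
  by move/eqP; rewrite oner_eq0.
move=> x Lx; have Gx := subsetP sLG x Lx.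
apply/matrixP=> i j; rewrite [in RHS]mxE.
have Gj := enum_valP j.
(* Right translation by [x] moves the coefficient at [g * x^-1] to [g]. *)
pose k := gring_index G (enum_val j * x^-1).
have Ek : enum_val k = enum_val j * x^-1.
  by rewrite gring_indexK ?groupM ?groupV.
rewrite (bigD1 k) //= big1 => [|l l_k]; last first.
  rewrite !mxE eqxx /=; case: eqP => [jE|]; last by rewrite mulr0.
  case/eqP: l_k; apply: (can_inj (@gring_valK _ G)).
  by rewrite Ek jE gring_indexK ?groupM ?enum_valP // mulgK.
rewrite addr0 !mxE Ek mulgKV gring_valK !eqxx mulr1.
have -> : (\sum_l rL x i l * B l j)%R = (rL x *m col j B)%R i 0%R.
  by rewrite mxE; apply: eq_bigr => l _; rewrite !mxE.
rewrite colB /u groupMr ?groupV //; case: ifP => Lj; last by rewrite mulmx0.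
by rewrite mulmxA -repr_mxM ?groupV // invMg invgK.
Qed.

(** A map into a completely reducible module can be projected onto one of two
    complementary submodules without vanishing, so descent on the rank of the
    target ends in a simple submodule. *)
Lemma intertwines_simple (F : fieldType) (gT : finGroupType)
    (L G : {group gT}) (n m : nat) (rL : mx_representation F L n)
    (rG : mx_representation F G m) (M : 'M[F]_m) (B : 'M[F]_(n, m)) :
  mx_completely_reducible rG 1%:M -> L \subset G -> mxmodule rG M ->
  intertwines rL rG B -> (B <= M)%MS -> B != 0%R ->
  exists2 U, mxsimple rG U &
    exists B', [/\ intertwines rL rG B', (B' <= U)%MS & B' != 0%R].
Proof.
move=> redG sLG; have [r] := ubnP (\rank M).
elim: r M B => // r IHr M B leMr modM homB sBM nzB.
have nzM : M != 0%R by apply: contraNneq nzB => M0; rewrite -submx0 -M0.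
have [simM | nsimM] := boolp.pselect (mxsimple rG M).
  by exists M => //; exists B.
have [N [modN sNM nzN nsMN]] : exists N : 'M_m,
    [/\ mxmodule rG N, (N <= M)%MS, N != 0%R & ~~ (M <= N)%MS].
  apply: boolp.contrapT => noN; apply: nsimM; split=> // N modN sNM nzN.
  by apply/negPn/negP=> nsMN; apply: noN; exists N.
have [N' modN' defM dxNN'] := mx_reducibleS modM (submx1 M) redG modN sNM.
have /mxdirect_addsP dxN := dxNN'.
have dxN' : (N' :&: N)%MS = 0%R by rewrite capmxC.
have sBNN' : (B <= N + N')%MS by rewrite defM.
have homP (P Q : 'M_m) : mxmodule rG P -> mxmodule rG Q ->
    (P :&: Q)%MS = 0%R -> (B <= P + Q)%MS ->
    intertwines rL rG (B *m proj_mx P Q)%R.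
  move=> modP modQ dxPQ sBPQ x Lx; have Gx := subsetP sLG x Lx.
  rewrite mulmxA homB //.
  exact: (hom_mxP (submx_trans sBPQ (proj_mx_hom dxPQ modP modQ))).
have rkM : (\rank N + \rank N')%N = \rank M.
  by rewrite -defM (mxdirectP dxNN').
have [BN0 | nzBN] := eqVneq (B *m proj_mx N N')%R 0%R.
  apply: (IHr N' (B *m proj_mx N' N)%R) => //.
  - rewrite -ltnS (leq_trans _ leMr) // ltnS -rkM.
    by rewrite -[X in X < _]add0n ltn_add2r lt0n mxrank_eq0.
  - by apply: homP => //; rewrite addsmxC.
  - exact: proj_mx_sub.
  - apply: contraNneq nzB => BN'0.
    by rewrite -(add_proj_mx dxN sBNN') BN0 BN'0 addr0.
apply: (IHr N (B *m proj_mx N N')%R) => //; last exact: proj_mx_sub.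
- rewrite -ltnS (leq_trans _ leMr) // ltnS ltn_neqAle mxrankS // andbT.
  apply: contraNneq nsMN => eqr.
  by rewrite -(geq_leqif (mxrank_leqif_sup sNM)) eqr.
exact: homP.
Qed.

(** This provides what inducing from [L] to [G] would: an irreducible
    representation of [G] whose restriction to [L] receives a nonzero map. *)
Lemma hom_irreducible_constituent (F : fieldType) (gT : finGroupType)
    (L G : {group gT}) (n : nat) (rL : mx_representation F L n) :
  [pchar F]%R^'.-group G -> L \subset G -> 0 < n ->
  exists m, exists (rW : mx_representation F G m) (B : 'M[F]_(n, m)),
    [/\ mx_irreducible rW, intertwines rL rW B & B != 0%R].
Proof.
move=> F'G sLG n_gt0.
have [B0 nzB0 homB0] := intertwines_regular rL sLG n_gt0.
have [U simU [B [homB sBU nzB]]] := intertwines_simple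
  (mx_Maschke_pchar _ F'G) sLG (mxmodule1 _) homB0 (submx1 _) nzB0.
have modU := mxsimple_module simU.
exists (\rank U), (submod_repr modU), (in_submod U B); split.
- exact/submod_mx_irr.
- move=> x Lx; rewrite -(in_submodJ modU x sBU) -homB //.
  by rewrite in_submodE mulmxA -in_submodE.
by apply: contra nzB => /eqP B0'; rewrite -(in_submodK sBU) B0' linear0.
Qed.

(** Schur's lemma: the kernel is a submodule. *)
Lemma intertwines_row_free (F : fieldType) (gT : finGroupType)
    (L G : {group gT}) (n m : nat) (rL : mx_representation F L n)
    (rG : mx_representation F G m) (B : 'M[F]_(n, m)) :
  mx_irreducible rL -> intertwines rL rG B -> B != 0%R -> row_free B.
Proof.
move=> [_ _ irrL] homB nzB; rewrite -kermx_eq0; apply: contraNT nzB => nzK.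
have modK : mxmodule rL (kermx B).
  apply/mxmoduleP=> x Lx; apply/sub_kermxP.
  by rewrite -mulmxA homB // mulmxA mulmx_ker mul0mx.
have /sub_kermxP := irrL _ modK (submx1 _) nzK.
by rewrite mul1mx => ->.
Qed.

Lemma intertwines_rfix (F : fieldType) (gT : finGroupType)
    (H L G : {group gT}) (n m : nat) (rL : mx_representation F L n)
    (rG : mx_representation F G m) (B : 'M[F]_(n, m)) :
  intertwines rL rG B -> H \subset L ->
  ((rfix_mx rL H *m B)%R <= rfix_mx rG H)%MS.
Proof.
move=> homB sHL; apply/rfix_mxP=> x Hx.
by rewrite -mulmxA -homB ?(subsetP sHL) // mulmxA rfix_mx_id.
Qed.

Lemma sub_rstab_rfix (F : fieldType) (gT : finGroupType) (H G : {group gT})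
    (n : nat) (rG : mx_representation F G n) :
  H \subset G -> H \subset rstab rG (rfix_mx rG H).
Proof.
move=> sHG; apply/subsetP=> x Hx.
by rewrite inE (subsetP sHG) // rfix_mx_id /=.
Qed.

(** An element of [L] fixing the image [V^H *m B] of [V^H] inside [W^H] fixes
    [V^H] itself, because [B] is injective and commutes with [L]. *)
Lemma stab_fixed_constituent (F : fieldType) (gT : finGroupType)
    (H L G : {group gT}) (n m : nat) (rL : mx_representation F L n)
    (rG : mx_representation F G m) (B : 'M[F]_(n, m)) :
  L \subset G -> H \subset L -> intertwines rL rG B -> row_free B ->
  rstab rL (rfix_mx rL H) = H -> L :&: rstab rG (rfix_mx rG H) = H.
Proof.
move=> sLG sHL homB freeB stabH; apply/eqP; rewrite eqEsubset subsetI sHL.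
rewrite sub_rstab_rfix ?(subset_trans sHL) //.
suffices : L :&: rstab rG (rfix_mx rG H) \subset rstab rL (rfix_mx rL H).
  by rewrite stabH => ->.
apply/subsetP=> x /setIP[Lx]; rewrite !inE Lx => /andP[_ /eqP fixx] /=.
apply/eqP/(row_free_inj freeB); rewrite -mulmxA homB // mulmxA.
have /submxP[D ->] := intertwines_rfix homB sHL.
by rewrite -mulmxA fixx.
Qed.

(** If [V^H = 0] then its stabiliser [L] equals [H], and the trivial
    representation of [G] has the required properties; this case is separate
    because the fixed space of [H] must be nonzero for the sign twist to
    change its stabiliser. *)
Lemma irreducible_stab_cap (F : fieldType) (gT : finGroupType)
    (H L G : {group gT}) (n : nat) (rL : mx_representation F L n) :
  [pchar F]%R^'.-group G -> L \subset G -> H \subset L ->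
  mx_irreducible rL -> rstab rL (rfix_mx rL H) = H ->
  exists m (rG : mx_representation F G m),
    [/\ mx_irreducible rG, rfix_mx rG H != 0%R &
        L :&: rstab rG (rfix_mx rG H) = H].
Proof.
move=> F'G sLG sHL irrL stabL.
have [fix0 | nzfix] := eqVneq (rfix_mx rL H) 0%R.
  have LH : L = H :> {set gT}.
    by rewrite -stabL fix0; apply/setP=> x; rewrite inE mul0mx eqxx andbT.
  have reprG1 : mx_repr G (fun=> 1%:M%R : 'M[F]_1).
    by split=> // x y _ _; rewrite mulmx1.
  pose rG := MxRepresentation reprG1.
  have fixG : (1%:M%R <= rfix_mx rG H)%MS.
    by apply/rfix_mxP=> x _; rewrite mulmx1.
  exists 1%N, rG; split.
  - by apply: linear_mxsimple; rewrite ?mxmodule1 ?mxrank1.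
  - by apply: contraTneq fixG => ->; rewrite submx0 oner_eq0.
  - rewrite -[RHS]LH; apply/setIidPl/subsetP=> x Lx.
    by rewrite inE (subsetP sLG) //= mulmx1.
have n_gt0 : 0 < n by have /mx_irrP[] := irrL.
have [m [rG [B [irrG homB nzB]]]] :=
  hom_irreducible_constituent rL F'G sLG n_gt0.
have freeB := intertwines_row_free irrL homB nzB.
exists m, rG; split=> //.
  apply: contraNneq nzfix => fixG0; have := intertwines_rfix homB sHL.
  by rewrite fixG0 submx0 -!mxrank_eq0 mxrankMfree.
exact: stab_fixed_constituent homB freeB stabL.
Qed.

(** * Twisting by the sign character of an index 2 subgroup *)

Lemma index2_mem_mul (gT : finGroupType) (L G : {group gT}) :
  L \subset G -> #|G : L| = 2 ->
  {in G &, forall x y, (x * y \in L) = ((x \in L) == (y \in L))}.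
Proof.
move=> sLG iL x y Gx Gy.
have [Lx | nLx] := boolP (x \in L); first by rewrite groupMl //; case: (y \in L).
have [Ly | nLy] := boolP (y \in L); first by rewrite groupMr // (negPf nLx).
have GLy : y^-1 \in G :\: L by rewrite inE !groupV nLy.
have := rcoset_index2 sLG iL GLy; move/setP/(_ x).
by rewrite mem_rcoset invgK !inE nLx Gx.
Qed.

Lemma sign_twist_repr (F : fieldType) (gT : finGroupType) (L G : {group gT})
    (n : nat) (rG : mx_representation F G n) :
  L \subset G -> #|G : L| = 2 ->
  mx_repr G (fun x => if x \in L then rG x else (- rG x)%R).
Proof.
move=> sLG iL; split=> [|x y Gx Gy]; first by rewrite group1 repr_mx1.
rewrite (index2_mem_mul sLG iL) // repr_mxM //.
by case: (x \in L); case: (y \in L); rewrite /= ?mulmxN ?mulNmx ?opprK.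
Qed.

(** The twist is a relation between representations rather than a function,
    which spares its users the proofs that [L] has index 2 in [G]. *)
Definition is_sign_twist (F : fieldType) (gT : finGroupType) (L G : {group gT})
    (n : nat) (rG rT : mx_representation F G n) : Prop :=
  forall x, rT x = if x \in L then rG x else (- rG x)%R.

Lemma sign_twist_irr (F : fieldType) (gT : finGroupType) (L G : {group gT})
    (n : nat) (rG rT : mx_representation F G n) :
  is_sign_twist L rG rT -> mx_irreducible rG -> mx_irreducible rT.
Proof.
move=> rTE [_ nz1 irrG]; split=> [||U modU]; [exact: mxmodule1 | done |].
apply: irrG; apply/mxmoduleP=> x Gx; have := mxmoduleP modU x Gx.
by rewrite rTE; case: ifP => // _; rewrite mulmxN eqmx_opp.
Qed.

Lemma sign_twist_rfix (F : fieldType) (gT : finGroupType) (H L G : {group gT})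
    (n : nat) (rG rT : mx_representation F G n) :
  is_sign_twist L rG rT -> H \subset L ->
  (rfix_mx rT H :=: rfix_mx rG H)%MS.
Proof.
move=> rTE sHL; have eqH x : x \in H -> rT x = rG x.
  by move=> Hx; rewrite rTE (subsetP sHL).
apply/eqmxP/andP; split; apply/rfix_mxP=> x Hx.
  by rewrite -eqH ?rfix_mx_id.
by rewrite eqH ?rfix_mx_id.
Qed.

Lemma eqmx_rstab (F : fieldType) (gT : finGroupType) (G : {group gT})
    (n m1 m2 : nat) (rG : mx_representation F G n)
    (U1 : 'M[F]_(m1, n)) (U2 : 'M[F]_(m2, n)) :
  (U1 :=: U2)%MS -> rstab rG U1 = rstab rG U2.
Proof.
by move/eqmxP/andP=> [s12 s21]; apply/eqP; rewrite eqEsubset !rstabS.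
Qed.

Lemma sign_twist_stab (F : fieldType) (gT : finGroupType) (H L G : {group gT})
    (n : nat) (rG rT : mx_representation F G n) :
  is_sign_twist L rG rT -> H \subset L ->
  L :&: rstab rT (rfix_mx rT H) = L :&: rstab rG (rfix_mx rG H).
Proof.
move=> rTE sHL; rewrite (eqmx_rstab rT (sign_twist_rfix rTE sHL)).
by apply/setP=> x; rewrite !inE rTE; case: (x \in L).
Qed.

(** An element outside [L] fixing the common [H]-fixed space in both [rG] and
    the twist would act on it as [1] and as [-1] at the same time. *)
Lemma sign_twist_stab_sub (F : fieldType) (gT : finGroupType)
    (H L G : {group gT}) (n : nat) (rG rT : mx_representation F G n) :
  is_sign_twist L rG rT -> H \subset L ->
  2%:R%R != 0%R :> F -> rfix_mx rG H != 0%R ->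
  rstab rG (rfix_mx rG H) = rstab rT (rfix_mx rT H) ->
  rstab rG (rfix_mx rG H) \subset L.
Proof.
move=> rTE sHL nz2 nzfix eqK; apply/subsetP=> x Kx.
have /setIdP[_ /eqP fixG] := Kx.
move: Kx; rewrite eqK (eqmx_rstab rT (sign_twist_rfix rTE sHL)).
case/setIdP=> _; rewrite rTE; case: ifP => // _.
rewrite mulmxN fixG -subr_eq0 -opprD oppr_eq0 -mulr2n -scaler_nat.
by rewrite scaler_eq0 (negPf nz2) (negPf nzfix).
Qed.

(** * Complements of a coatom *)

(** A subgroup meeting the maximal subgroup [L] in [H] is [H] or generates [G]
    together with [L]; in the second case it is the complement of [L]. *)
Lemma boolean_interval_maximal_compl (gT : finGroupType) (H L G : {group gT}) :
  boolean_interval H G -> interval_coatom H G L ->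
  forall K1 K2 : {group gT}, K1 \subset G -> K2 \subset G ->
  L :&: K1 = H -> L :&: K2 = H -> K1 <> H :> {set gT} -> K2 <> H :> {set gT} ->
  K1 = K2.
Proof.
move=> [_ complG] /andP[sHL maxL] K1 K2 sK1G sK2G LK1 LK2 K1_H K2_H.
have sLG : L \subset G := proper_sub (maxgroupp maxL).
have intL : in_interval H G L by rewrite /in_interval sHL.
have isCompl (K : {group gT}) :
    K \subset G -> L :&: K = H -> K <> H :> {set gT} ->
    interval_complement H G L K.
  move=> sKG LK K_H; split=> //; first by rewrite /in_interval sKG -LK subsetIr.
  have nsKL : ~~ (K \subset L).
    by apply: contra_notN K_H => sKL; rewrite -LK (setIidPr sKL).
  apply/eqP; rewrite eqEproper join_subG sLG sKG /=.
  apply/negP=> prLK; have [_ maxLP] := maxgroupP maxL.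
  case/negP: nsKL; rewrite -(maxLP (L <*> K)%G prLK (joing_subl _ _)).
  exact: joing_subr.
have [K0 [_ uniqK0]] := complG L intL.
by rewrite -(uniqK0 K1) ?(uniqK0 K2) //; apply: isCompl.
Qed.

(** * Linear primitivity *)

(** One of [rG] and its sign twist has stabiliser exactly [H]. *)
Lemma irreducible_stab_of_stab_cap (F : fieldType) (gT : finGroupType)
    (H L G : {group gT}) (n : nat) (rG : mx_representation F G n) :
  boolean_interval H G -> interval_coatom H G L -> #|G : L| = 2 ->
  2%:R%R != 0%R :> F -> mx_irreducible rG -> rfix_mx rG H != 0%R ->
  L :&: rstab rG (rfix_mx rG H) = H ->
  exists2 rW : mx_representation F G n,
    mx_irreducible rW & rstab rW (rfix_mx rW H) = H.
Proof.
move=> boolHG coatomL iL nz2 irrG nzfix stabG.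
have /andP[sHL maxL] := coatomL.
have sLG : L \subset G := proper_sub (maxgroupp maxL).
have [rT rTE] : exists rT, is_sign_twist L rG rT.
  by exists (MxRepresentation (sign_twist_repr rG sLG iL)).
have stabT := etrans (sign_twist_stab rTE sHL) stabG.
have [K_H | /eqP K_H] := eqVneq (rstab rG (rfix_mx rG H)) H.
  by exists rG.
have [K'_H | /eqP K'_H] := eqVneq (rstab rT (rfix_mx rT H)) H.
  by exists rT; first exact: sign_twist_irr rTE irrG.
(* Both stabilisers are now the complement of [L], hence equal; so they lie in
   [L] by [sign_twist_stab_sub], and are [H] after all. *)
have eqK := boolean_interval_maximal_compl boolHG coatomL
  (rstab_sub _ _) (rstab_sub _ _) stabG stabT K_H K'_H.
case: K_H; rewrite -[RHS]stabG; apply/esym/setIidPr.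
exact: (sign_twist_stab_sub rTE sHL nz2 nzfix (congr1 val eqK)).
Qed.

Theorem theorem1p6 (R : realType) (gT : finGroupType) (G H L : {group gT})
    (sHG : H \subset G) (boolHG : boolean_interval H G)
    (coatomL : interval_coatom H G L) (indexL : #|G : L| = 2) :
  linearly_primitive R H L -> linearly_primitive R H G.
Proof.
case=> n [rL [irrL stabL]].
have /andP[sHL maxL] := coatomL.
have sLG : L \subset G := proper_sub (maxgroupp maxL).
have C'G : [pchar R[i]]%R^'.-group G.
  by apply/pgroupP=> p _ _; rewrite inE /= pchar_num.
have nz2 : 2%:R%R != 0%R :> R[i] by rewrite pnatr_eq0.
have [m [rG [irrG nzfix stabG]]] := irreducible_stab_cap C'G sLG sHL irrL stabL.
have [rW irrW stabW] :=
  irreducible_stab_of_stab_cap boolHG coatomL indexL nz2 irrG nzfix stabG.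
by exists m, rW.
Qed.
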